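(* For $b_1,b_2\in[0,1]$ let $(\Sigma^{-1}_{1;b_1},\Sigma^{-1}_{2;b_2})$ denote a random vector in $[0,1]^2$ distributed according to the density $f_{b_1}(x_1)f_{b_2}(x_2)$, where $f_b$ is the density defined in the context. (i) Let $\hat b\approx.768$ be the root in $[0,1]$ of the equation $(1-b)e^b-\frac12=0$. Then $$P(\Sigma^{-1}_{1;b_1}<\Sigma^{-1}_{2;b_2})>\tfrac12\quad\text{for } b_1<b_2<\hat b\text{ and }b_2\text{ sufficiently close to }b_1;$$ $$P(\Sigma^{-1}_{1;b_1}<\Sigma^{-1}_{2;b_2})<\tfrac12\quad\text{for } \hat b<b_1<b_2\text{ and }b_2\text{ sufficiently close to }b_1$$ (where how close $b_2$ must be may depend on $b_1$). (ii) Let $E(b)=eb+\frac12e^{1-b}-e^b$, and let $\tilde b\approx.380$ be the unique root of the equation $E(b)=\frac12$ for $b\in[0,1)$. Then $$P(\Sigma^{-1}_{1;b}<\Sigma^{-1}_{2;1})>\tfrac12\quad\text{for } b\in[0,\tilde b);$$ $$P(\Sigma^{-1}_{1;b}<\Sigma^{-1}_{2;1})<\tfrac12\quad\text{for } b\in(\tilde b,1).$$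
   Context: For $b\in[0,1]$ define the increasing bijection $G_b:[0,1]\to[0,1]$ by $G_b(y)=ye^{1-b}$ for $0\le y\le 1-(1-b)e^b$ and $G_b(y)=e^{(1-y)e^{-b}}-(1-y)e^{1-b}$ for $1-(1-b)e^b\le y\le1$; let $F_b=G_b^{-1}$, a distribution function on $[0,1]$, and let $f_b=F_b'$ be its density (so $f_1\equiv1$). The number $E(b)$ equals the mean $\int_0^1xf_b(x)\,dx$. Probabilistic meaning: $f_b$ is the limiting density of $\frac1n$ times the final position of a card with number asymptotic to $bn$ after one card-cyclic to random insertion shuffle of $n$ cards started in increasing order (cards $1,2,\dots,n$ are, in this order, each removed once and reinserted in a uniformly random one of the $n$ positions), and the positions of two distinct such cards are asymptotically independent. The symbol $\approx$ indicates the numerical value to three decimal places. *)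

(* Defs.v *)
(* MathComp-Analysis *)
From HB Require Import structures.
From mathcomp Require Export all_boot all_order all_algebra.
From mathcomp Require Export all_classical all_reals all_analysis.
Export Order.TTheory GRing.Theory Num.Theory.
Export numFieldNormedType.Exports.

Set Implicit Arguments.
Unset Strict Implicit.
Unset Printing Implicit Defensive.

Local Open Scope classical_set_scope.
Local Open Scope ring_scope.

(* The two branches agree at the breakpoint; only the values of [G b] on
   [0, 1] matter. *)
Definition G {R : realType} (b y : R) : R :=
  if y <= 1 - (1 - b) * expR b then y * expR (1 - b)
  else expR ((1 - y) * expR (- b)) - (1 - y) * expR (1 - b).

(* [G b] is a bijection of [0, 1] onto itself when b is in [0, 1], so on [0, 1]
   [F b] is its inverse; outside [0, 1] it takes the default value 0. *)
Definition F {R : realType} (b : R) : R -> R :=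
  'pinv_(fun=> 0) `[0, 1]%classic (G b).

(* [F b] may fail to be differentiable at 0, at 1 and at the image under [G b]
   of the breakpoint; the value of [f b] there is arbitrary and affects no
   integral. *)
Definition f {R : realType} (b : R) : R -> R := derive1 (F b).

(* The random vector [Sigma] (taking the values x.1 = Sigma_1 and
   x.2 = Sigma_2) is distributed on [0, 1]^2 according to the density
   f_{b1}(x1) f_{b2}(x2) with respect to planar Lebesgue measure. *)
Definition has_density_f {R : realType} {d : measure_display}
    {T : measurableType d} {P : probability T R}
    (Sigma : {RV P >-> (R * R)%type}) (b1 b2 : R) : Prop :=
  forall A : set (R * R), measurable A ->
    distribution P Sigma A =
    (\int[(@lebesgue_measure R) \x (@lebesgue_measure R)]_(x in
        A `&` (`[0%R, 1%R] `*` `[0%R, 1%R])) (f b1 x.1 * f b2 x.2)%:E)%E.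

Definition E {R : realType} (b : R) : R :=
  expR 1 * b + 2^-1 * expR (1 - b) - expR b.

(* Main.v *)
Require Import Defs.
From mathcomp Require Import measurable_realfun.
From mathcomp Require Import ring lra.

(* Write c(b) = 1 - (1 - b) e^b and h(s) = e^s - e s. In the variable
   s = (1 - y) e^{-b}, the upper branch of G_b is h(s), whatever b is; hence, for
   b1 < b2 and r = e^{b2 - b1}, F_{b2} = r F_{b1} below G_{b1}(c(b1)) and
   1 - F_{b2} = r (1 - F_{b1}) above G_{b2}(c(b2)). By Fubini,
   P(Sigma_1 < Sigma_2) is the integral of f_{b1} (1 - F_{b2}), which is therefore
   explicit outside a middle interval of F_{b1}-mass (b2 - b1) e^{b1}, where
   1 - F_{b2} is monotone. To first order in b2 - b1 the probability is
   1/2 + (b2 - b1) (2 (1 - b1) e^{b1} - 1) / 2, and the error is quadratic.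
   For b2 = 1 the probability is 1 - E(b); E(0) < 1/2 = E(1) and E' changes
   sign at most once, from + to -. *)

Set Implicit Arguments.
Unset Strict Implicit.
Unset Printing Implicit Defensive.

Local Open Scope classical_set_scope.
Local Open Scope ring_scope.

(** The delicate parameter is [b = 0]. Its breakpoint is 0 and its upper branch has slope 0 there,
    so [f 0] is unbounded near 0, and the fundamental theorem of calculus, which wants an integrand
    continuous up to the closed ends, cannot start at 0. Three devices avoid this end: integrals
    over the upper branch start at a positive point; the mass of the middle interval is found as a
    complement, the total mass 1 being read off from [P]; and for [b = 0] against 1 the probability
    is bounded below after cutting off a neighbourhood of 0. Crude bounds suffice on the middle
    interval: its mass is already of first order in b2 - b1, and there 1 - F_{b2} varies only by an
    amount of first order, so the bounds differ at second order. The derivative of [F b] is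
    controlled only away from 0, 1 and the image of the breakpoint. Hence all integrals run over
    open intervals, and the rest of the square is a null set on which only measurability is
    needed. *)

(** * Decimal bounds for the exponential *)

Lemma exp_coeffS (R : realType) (x : R) (n : nat) :
  exp_coeff x n.+1 = x / n.+1%:R * exp_coeff x n.
Proof. by rewrite /exp_coeff/= exprS factS natrM invfM mulrACA. Qed.

Lemma exp_coeff0n (R : realType) (x : R) : exp_coeff x 0 = 1.
Proof. by rewrite /exp_coeff/= expr0 fact0 divr1. Qed.

Lemma expR_series_le (R : realType) (x : R) (n : nat) : 0 <= x ->
  series (exp_coeff x) n <= expR x.
Proof.
move=> x0; apply: nondecreasing_cvgn_le; last exact: is_cvg_series_exp_coeff.
apply/nondecreasing_seqP => k.
by rewrite seriesSr lerDl exp_coeff_ge0.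
Qed.

(* The partial sums augmented by twice the first omitted term decrease. *)
Lemma expR_le_series (R : realType) (x : R) (n : nat) : (0 < n)%N ->
  0 <= x -> x <= 1 ->
  expR x <= series (exp_coeff x) n + 2 * exp_coeff x n.
Proof.
move=> n0 x0 x1; apply: limr_le; first exact: is_cvg_series_exp_coeff.
exists n => // k /= /subnK <-; move: (k - n)%N => {}k.
suff : series (exp_coeff x) (k + n)%N + 2 * exp_coeff x (k + n)%N
    <= series (exp_coeff x) n + 2 * exp_coeff x n.
  by apply: le_trans; rewrite lerDl mulr_ge0// exp_coeff_ge0.
elim: k => [|k] //; apply: le_trans.
rewrite addSn seriesSr -addrA lerD2l.
set N := (k + n)%N; have N1 : (0 < N)%N by rewrite /N addn_gt0 n0 orbT.
rewrite exp_coeffS.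
have e0 : 0 <= exp_coeff x N by rewrite exp_coeff_ge0.
(* As [x <= 1] and [N >= 1], each term is at most half of the previous one, so twice the term of
   index [N] covers both that term itself and twice the next one. *)
have : x / N.+1%:R <= 2^-1.
  rewrite ler_pdivrMr// (le_trans x1)// -(@ler_pM2l _ 2)// mulrA mulfV// mul1r mulr1.
  by rewrite ler_nat.
move=> /(ler_wpM2r e0).
by move: (x / N.+1%:R * exp_coeff x N) => u; lra.
Qed.

Ltac expR_lower N :=
  apply: le_trans (@expR_series_le _ _ N _); last lra;
  rewrite /series/= big_mkord !big_ord_recr big_ord0/= !exp_coeffS exp_coeff0n;
  lra.

Ltac expR_upper N :=
  apply: (le_trans (@expR_le_series _ _ N _ _ _)); [by []|lra|lra|];
  rewrite /series/= big_mkord !big_ord_recr big_ord0/= !exp_coeffS exp_coeff0n;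
  lra.

(* Numerals are unary, so 0.3795 is written 759/40/50, and so on. *)
Lemma expR1_ge (R : realType) : 2 + 718/1000 + 2/100/100 <= expR 1 :> R.
Proof. expR_lower 9%N. Qed.

Lemma expR1_le (R : realType) : expR 1 <= 2 + 718/1000 + 282/1000/1000 :> R.
Proof. expR_upper 12%N. Qed.

(** The arguments 0.3795 and 0.3805 are the ends of the permitted error 1/2000 around 0.380; below,
    0.7675 and 0.7685 play this part for 0.768. A sign change between the ends gives a root together
    with its decimals. *)
Lemma expR_3795_ge (R : realType) : 1 + 461/1000 + 54/100/1000 <= expR (759/40/50) :> R.
Proof. expR_lower 6%N. Qed.

Lemma expR_3805_le (R : realType) : expR (761/40/50) <= 1 + 463/1000 + 4/100/1000 :> R.
Proof. expR_upper 6%N. Qed.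

Lemma expR_7675_ge (R : realType) : 2 + 152/1000 <= expR (307/400) :> R.
Proof. expR_lower 6%N. Qed.

Lemma expR_7685_le (R : realType) : expR (1537/40/50) <= 2 + 159/1000 :> R.
Proof. expR_upper 6%N. Qed.

(** * The function [E] and its crossing of the level 1/2 *)

Lemma derivable1_continuous (R : realType) (g dg : R -> R) :
  (forall x : R, is_derive x 1 g (dg x)) -> continuous g.
Proof.
by move=> gd x; apply: differentiable_continuous; apply/derivable1_diffP.
Qed.

Lemma is_derive_expR_affine (R : realType) (a b x : R) :
  is_derive x 1 (fun y => expR (a * y + b)) (a * expR (a * x + b)).
Proof.
have d : is_derive x 1 (fun y => a * y + b) a.
  by apply: is_derive_eq; rewrite /GRing.scale/=; ring.
rewrite [a * expR _]mulrC -[fun y => _]/(expR \o (fun y => a * y + b)).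
exact: is_derive1_comp.
Qed.

Lemma is_derive_E (R : realType) (x : R) :
  is_derive x 1 E (expR 1 - 2^-1 * expR (1 - x) - expR x).
Proof.
have d := is_derive_expR_affine (-1) 1 x.
have -> : E = (fun b : R => expR 1 * b + 2^-1 * expR (-1 * b + 1) - expR b).
  by apply/funext => b; rewrite /E mulN1r (addrC (- b)).
have -> : 1 - x = -1 * x + 1 by ring.
by apply: is_derive_eq; rewrite /GRing.scale/=; ring.
Qed.

(** Otherwise the mean value theorem on [a, b] and on [b, 1], where [E 1 = 1/2], gives a point with
    E' <= 0 followed by a point with E' >= 0. With a root in the place of [b] or of [a], the lemma
    fixes the sign of [E - 1/2] on either side of the root. *)
Lemma E_no_valley (R : realType) (a b : R) : 0 <= a -> a < b -> b < 1 ->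
  2^-1 <= E a -> 2^-1 < E b.
Proof.
move=> a0 ab b1 Ea; rewrite ltNge; apply/negP => Eb.
have cE : continuous (@E R) := derivable1_continuous (@is_derive_E R).
have E1 : E 1 = 2^-1 :> R by rewrite /E subrr expR0; ring.
have [x xab ex] := MVT ab (fun x _ => is_derive_E x) (continuous_subspaceT cE).
have [y yb1 ey] := MVT b1 (fun x _ => is_derive_E x) (continuous_subspaceT cE).
move: xab yb1; rewrite !in_itv/= => /andP[ax xb] /andP[by_ y1].
have t1 : 1 < expR x by rewrite expR_gt1; lra.
have tu : expR x < expR y by rewrite ltr_expR; lra.
rewrite E1 in ey.
have dx : expR 1 - 2^-1 * expR (1 - x) - expR x <= 0 by nra.
have dy : 0 <= expR 1 - 2^-1 * expR (1 - y) - expR y by nra.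
move: dx dy; rewrite !expRD !expRN.
have e1 := expR1_ge R.
move: t1 tu; set e := expR 1; set t := expR x; set u := expR y => t1 tu.
(* With [t = e^x] the derivative of [E] is [q t / t] for a quadratic [q],
   concave and positive at 1, which cannot change sign from - to +. *)
have qE v : 0 < v -> e - 2^-1 * (e / v) - v = (- v ^+ 2 + e * v - e / 2) / v.
  by move=> v0; field; rewrite gt_eqF.
rewrite !qE; [|lra..].
have t0 : 0 < t by lra.
have u0 : 0 < u by lra.
rewrite pmulr_lle0 ?invr_gt0// pmulr_lge0 ?invr_gt0//.
set qt := _ - _; set qu := _ - _.
move=> qt0 qu0.
(* Interpolation of [q] at [t] between 1 and [u]: [e / 2 - 1] is [q 1], and the last product is the
   gain from strict concavity (leading coefficient -1). All terms on the right are nonnegative, two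
   of them positive. *)
have : qt * (u - 1) =
    (e / 2 - 1) * (u - t) + qu * (t - 1) + (t - 1) * (u - t) * (u - 1).
  by rewrite /qt /qu; field.
have : 0 < (e / 2 - 1) * (u - t) by apply: mulr_gt0; rewrite /e; lra.
have : 0 <= qu * (t - 1) by apply: mulr_ge0; lra.
have : 0 < (t - 1) * (u - t) * (u - 1) by rewrite !mulr_gt0; lra.
have : qt * (u - 1) <= 0 by apply: mulr_le0_ge0; lra.
lra.
Qed.

(** After multiplication by [2 t], where [t] is the exponential of 0.3795, the claim is polynomial
    in [t] and [e]. The gap to 1/2 is less than 0.00004, which dictates the precision of the bounds
    used. *)
Lemma E_3795_lt (R : realType) : E (759/40/50 : R) < 2^-1.
Proof.
have e0 := expR_gt0 (1 : R).
rewrite /E expRD expRN.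
have := expR_3795_ge R; have t0 := expR_gt0 (759/40/50 : R).
have := expR1_le R; move: e0 t0.
set e := expR 1; set t := expR _ => e0 t0 el tl.
rewrite -subr_gt0.
have -> : 2^-1 - (e * (759 / 40 / 50) + 2^-1 * (e / t) - t)
    = (t * (1 - 759/20/50 * e + 2 * t) - e) / (2 * t).
  by field; rewrite gt_eqF.
by apply: divr_gt0; [nra|rewrite mulr_gt0].
Qed.

Lemma E_3805_gt (R : realType) : 2^-1 < E (761/40/50 : R).
Proof.
have e0 := expR_gt0 (1 : R).
rewrite /E expRD expRN.
have := expR_3805_le R; have := expR_gt1 (761/40/50 : R).
have -> : (0 < 761 / 40 / 50 :> R) by lra.
have := expR1_ge R; move: e0.
set e := expR 1; set t := expR _ => e0 el t1 tl.
have t0 : 0 < t by lra.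
rewrite -subr_gt0.
have -> : (e * (761 / 40 / 50) + 2^-1 * (e / t) - t) - 2^-1
    = (e - t * (1 - 761/20/50 * e + 2 * t)) / (2 * t).
  by field; rewrite gt_eqF.
by apply: divr_gt0; [nra|rewrite mulr_gt0].
Qed.

Lemma E_root (R : realType) : exists b : R,
  [/\ 0 <= b < 1, E b = 2^-1, `|b - 380%:R / 1000%:R| < 2000%:R^-1,
      (forall x, 0 <= x < b -> E x < 2^-1) &
      (forall x, b < x < 1 -> 2^-1 < E x)].
Proof.
have cE : continuous (@E R) := derivable1_continuous (@is_derive_E R).
have lo := E_3795_lt R; have hi := E_3805_gt R.
have [||b] := @IVT R E (759/40/50) (761/40/50) 2^-1 _ (continuous_subspaceT cE).
- lra.
- by rewrite ge_min le_max (ltW lo) (ltW hi) orbT.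
rewrite in_itv/= => /andP[b1 b2] Eb.
(* [IVT] yields a closed interval, while the distance to 0.380 must be strictly below 1/2000. *)
have {}b1 : 759/40/50 < b.
  by rewrite lt_neqAle b1 andbT; apply: contraTneq lo => ->; rewrite Eb ltxx.
have {}b2 : b < 761/40/50.
  by rewrite lt_neqAle b2 andbT; apply: contraTneq hi => <-; rewrite Eb ltxx.
exists b; split => //.
- by apply/andP; split; lra.
- rewrite ltr_norml; apply/andP; split; lra.
- move=> x /andP[x0 xb]; rewrite ltNge; apply/negP => Ex.
  have b1' : b < 1 by lra.
  by have := E_no_valley x0 xb b1' Ex; rewrite Eb ltxx.
- move=> x /andP[bx x1]; apply: (E_no_valley _ bx) => //; first lra.
  by rewrite Eb.
Qed.

(** * The equation that defines the first root *)

(** Length of the part of [0, 1] on which [G b] follows its upper branch; the first root is the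
    parameter at which this is half of the interval. *)
Definition upper_width (R : realType) (b : R) : R := (1 - b) * expR b.

Lemma is_derive_upper_width (R : realType) (x : R) :
  is_derive x 1 (@upper_width R) (- x * expR x).
Proof.
by rewrite /upper_width; apply: is_derive_eq; rewrite /GRing.scale/=; ring.
Qed.

Lemma upper_width_decr (R : realType) (a b : R) : 0 <= a -> a < b ->
  upper_width b < upper_width a.
Proof.
move=> a0 ab; have cS := derivable1_continuous (@is_derive_upper_width R).
have [x] := MVT ab (fun x _ => is_derive_upper_width x) (continuous_subspaceT cS).
rewrite in_itv/= => /andP[ax xb] e; rewrite -subr_lt0 e.
by rewrite mulNr mulNr oppr_lt0 !mulr_gt0 ?expR_gt0//; lra.
Qed.

Lemma upper_width_root (R : realType) : exists b : R,
  [/\ 0 <= b <= 1, upper_width b = 2^-1 & `|b - 768%:R / 1000%:R| < 2000%:R^-1].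
Proof.
have cS := derivable1_continuous (@is_derive_upper_width R).
have lo : 2^-1 < upper_width (307/400 : R).
  by rewrite /upper_width; have := expR_7675_ge R; nra.
have hi : upper_width (1537/40/50 : R) < 2^-1.
  by rewrite /upper_width; have := expR_7685_le R; nra.
have [||b] := @IVT R _ (307/400) (1537/40/50) 2^-1 _ (continuous_subspaceT cS).
- lra.
- by rewrite ge_min le_max (ltW lo) (ltW hi) orbT.
rewrite in_itv/= => /andP[b1 b2] Sb.
have {}b1 : 307/400 < b.
  by rewrite lt_neqAle b1 andbT; apply: contraTneq lo => ->; rewrite Sb ltxx.
have {}b2 : b < 1537/40/50.
  by rewrite lt_neqAle b2 andbT; apply: contraTneq hi => <-; rewrite Sb ltxx.
exists b; split => //; first by apply/andP; split; lra.
by rewrite ltr_norml; apply/andP; split; lra.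
Qed.

(* In the variable [s = (1 - y) e^{-b}] the upper branch of [G b] does not
   depend on [b]. *)
Definition upper (R : realType) (s : R) : R := expR s - s * expR 1.

Lemma is_derive_upper (R : realType) (s : R) :
  is_derive s 1 (@upper R) (expR s - expR 1).
Proof. by rewrite /upper; apply: is_derive_eq; rewrite /GRing.scale/=; ring. Qed.

Lemma upper_decr (R : realType) (s t : R) : s < t -> t <= 1 -> upper t < upper s.
Proof.
move=> st t1; have cU := derivable1_continuous (@is_derive_upper R).
have [x] := MVT st (fun x _ => is_derive_upper x) (continuous_subspaceT cU).
rewrite in_itv/= => /andP[sx xt] e; rewrite -subr_lt0 e.
have : expR x < expR 1 by rewrite ltr_expR; lra.
by nra.
Qed.

Lemma upper0 (R : realType) : upper 0 = 1 :> R.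
Proof. by rewrite /upper expR0 mul0r subr0. Qed.

Definition breakpoint (R : realType) (b : R) : R := 1 - upper_width b.

(** The image of the breakpoint under [G b], where [s = 1 - b]. Written through the upper branch,
    its growth with [b] follows at once from the decrease of [upper]. *)
Definition breakvalue (R : realType) (b : R) : R := upper (1 - b).

(** * The bijection [G b], its inverse and the derivative of the inverse *)

Section distribution_function.
Variables (R : realType) (b : R).
Hypothesis b01 : 0 <= b <= 1.
Let b0 : 0 <= b. Proof. by case/andP: b01. Qed.
Let b1 : b <= 1. Proof. by case/andP: b01. Qed.
Local Notation c := (breakpoint b).
Local Notation k := (breakvalue b).

Lemma upper_width_ge0 : 0 <= upper_width b.
Proof. by rewrite mulr_ge0 ?expR_ge0// subr_ge0. Qed.

Lemma upper_width_le1 : upper_width b <= 1.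
Proof.
have s0 : upper_width 0 = 1 :> R by rewrite /upper_width expR0; ring.
move: b0; rewrite le_eqVlt => /predU1P[<-|b0']; first by rewrite s0.
by rewrite -[leRHS]s0 ltW// upper_width_decr.
Qed.

Lemma breakpoint_ge0 : 0 <= c.
Proof. by rewrite subr_ge0 upper_width_le1. Qed.

Lemma breakpoint_le1 : c <= 1.
Proof. by rewrite gerBl upper_width_ge0. Qed.

Lemma breakvalueE : k = c * expR (1 - b).
Proof.
rewrite /breakvalue /breakpoint /upper /upper_width.
have -> : expR 1 = expR b * expR (1 - b) by rewrite -expRD; congr expR; ring.
by ring.
Qed.

Lemma breakpoint_upper : (1 - c) * expR (- b) = 1 - b.
Proof.
by rewrite /breakpoint /upper_width expRN; field; rewrite gt_eqF ?expR_gt0.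
Qed.

Lemma G_lower y : y <= c -> G b y = y * expR (1 - b).
Proof. by rewrite /G => ->. Qed.

Lemma G_upper y : c <= y -> G b y = upper ((1 - y) * expR (- b)).
Proof.
have e : forall z, expR ((1 - z) * expR (- b)) - (1 - z) * expR (1 - b) =
    upper ((1 - z) * expR (- b)).
  by move=> z; rewrite /upper (expRD 1); ring.
rewrite le_eqVlt => /predU1P[<-|cy].
  by rewrite G_lower// breakpoint_upper -breakvalueE.
by rewrite /G lt_geF// e.
Qed.

Lemma G_breakpoint : G b c = k.
Proof. by rewrite G_lower// breakvalueE. Qed.

Lemma upper_arg_le y : c <= y -> (1 - y) * expR (- b) <= 1 - b.
Proof. by move=> cy; rewrite -breakpoint_upper ler_wpM2r ?expR_ge0// lerD2l lerN2. Qed.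

(** On the upper branch [s] decreases in [y] and stays at most [1 - b], hence within the range
    [s <= 1] where [upper] decreases. This also works outside [0, 1], so [G_mono] carries no side
    condition. *)
Lemma G_incr y z : y < z -> G b y < G b z.
Proof.
have lo x x' : x < x' -> x' <= c -> G b x < G b x'.
  move=> xx' x'c; rewrite !G_lower ?(le_trans (ltW xx'))//.
  by rewrite ltr_pM2r ?expR_gt0.
have hi x x' : x < x' -> c <= x -> G b x < G b x'.
  move=> xx' cx; rewrite !G_upper ?(le_trans cx (ltW xx'))//.
  apply: upper_decr; first by rewrite ltr_pM2r ?expR_gt0// ltrD2l ltrN2.
  by apply: (le_trans (upper_arg_le cx)); rewrite gerBl.
move=> yz; have [zc|cz] := leP z c; first exact: lo.
have [yc|cy] := leP c y; first exact: hi.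
by apply: (lt_trans (lo _ _ cy (lexx _))); exact: hi.
Qed.

Lemma G0 : G b 0 = 0.
Proof. by rewrite G_lower ?mul0r// breakpoint_ge0. Qed.

Lemma G1 : G b 1 = 1.
Proof. by rewrite G_upper ?breakpoint_le1// subrr mul0r upper0. Qed.

Lemma G_le y z : y <= z -> G b y <= G b z.
Proof. by rewrite le_eqVlt => /predU1P[->//|/G_incr/ltW]. Qed.

Lemma G_mono : {mono G b : y z / y <= z}.
Proof. by apply: le_mono => y z; exact: G_incr. Qed.

Lemma G_surj x : 0 <= x <= 1 -> exists2 y, 0 <= y <= 1 & G b y = x.
Proof.
move=> /andP[x0 x1]; have [xk|kx] := leP x k.
  have xc : x * expR (b - 1) <= c.
    have -> : c = k * expR (b - 1).
      rewrite breakvalueE -mulrA -expRD (_ : _ + _ = 0); last ring.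
      by rewrite expR0 mulr1.
    by rewrite ler_wpM2r ?expR_ge0.
  exists (x * expR (b - 1)).
    rewrite mulr_ge0 ?expR_ge0//=; exact: le_trans breakpoint_le1.
  rewrite G_lower// -mulrA -expRD (_ : _ + _ = 0); last ring.
  by rewrite expR0 mulr1.
have cU := derivable1_continuous (@is_derive_upper R).
(* The upper branch is inverted in the variable [s]: on [0, 1 - b] [upper] passes from 1 to the
   break value, and [y = 1 - s * expR b] recovers the argument. *)
have [||s] := @IVT R _ 0 (1 - b) x _ (continuous_subspaceT cU).
- by rewrite subr_ge0.
- by rewrite upper0 ge_min le_max x1 (ltW kx) orbT.
rewrite in_itv/= => /andP[s0 sb] <-.
have sE : s = (1 - (1 - s * expR b)) * expR (- b).
  by rewrite expRN; field; rewrite gt_eqF ?expR_gt0.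
have cs : c <= 1 - s * expR b.
  by rewrite /breakpoint lerD2l lerN2 ler_wpM2r ?expR_ge0.
exists (1 - s * expR b); last by rewrite G_upper// -sE.
by rewrite (le_trans breakpoint_ge0)//= gerBl mulr_ge0 ?expR_ge0.
Qed.

Lemma FK y : 0 <= y <= 1 -> F b (G b y) = y.
Proof.
move=> y01; apply: pinvKV; last by rewrite inE/= in_itv.
by move=> u v _ _ guv; apply: (inc_inj G_mono).
Qed.

Lemma F_spec x : 0 <= x <= 1 -> 0 <= F b x <= 1 /\ G b (F b x) = x.
Proof. by move=> /G_surj[y y01 <-]; rewrite FK. Qed.

Lemma GK x : 0 <= x <= 1 -> G b (F b x) = x.
Proof. by move=> /F_spec[]. Qed.

Lemma F_ge0 x : 0 <= x <= 1 -> 0 <= F b x.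
Proof. by move=> /F_spec[/andP[]]. Qed.

Lemma F_le1 x : 0 <= x <= 1 -> F b x <= 1.
Proof. by move=> /F_spec[/andP[]]. Qed.

Lemma F_mono x y : 0 <= x <= 1 -> 0 <= y <= 1 -> (F b x <= F b y) = (x <= y).
Proof. by move=> x01 y01; rewrite -G_mono !GK. Qed.

Lemma F_mono_lt x y : 0 <= x <= 1 -> 0 <= y <= 1 -> (F b x < F b y) = (x < y).
Proof. by move=> x01 y01; rewrite !ltNge F_mono. Qed.

Lemma F0 : F b 0 = 0.
Proof. by rewrite -{1}G0 FK// lexx ler01. Qed.

Lemma F1 : F b 1 = 1.
Proof. by rewrite -{1}G1 FK// lexx ler01. Qed.

Lemma breakvalue_ge0 : 0 <= k.
Proof. by rewrite -G_breakpoint -G0 G_le// breakpoint_ge0. Qed.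

Lemma breakvalue_le1 : k <= 1.
Proof. by rewrite -G_breakpoint -G1 G_le// breakpoint_le1. Qed.

Lemma F_breakvalue : F b k = c.
Proof. by rewrite -G_breakpoint FK// breakpoint_ge0 breakpoint_le1. Qed.

Lemma F_continuous : {within `[0, 1], continuous (F b)}.
Proof.
apply: segment_inc_surj_continuous.
  by move=> x y; rewrite !in_itv/=; exact: F_mono.
rewrite F0 F1 => y /=; rewrite in_itv/= => y01.
exists (G b y); last exact: FK.
by rewrite /= in_itv/= -{1}G0 -G1 !G_mono.
Qed.

Lemma G_continuous : {within `[0, 1], continuous (G b)}.
Proof.
apply: segment_inc_surj_continuous; first by move=> x y _ _; exact: G_mono.
rewrite G0 G1 => x /=; rewrite in_itv/= => x01.
by exists (F b x); [rewrite /= in_itv/= F_ge0 ?F_le1|exact: GK].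
Qed.

(** Inverse function rule; [g] is the formula of one branch, which can be differentiated without the
    case distinction in [G b]. *)
Lemma is_derive_F_branch (g : R -> R) (l u : R) : 0 < u < 1 ->
  (\near u, g u = G b u) -> is_derive u 1 g l -> l != 0 ->
  is_derive (G b u) 1 (F b) l^-1.
Proof.
move=> /andP[u0 u1] gG dg l0.
apply: is_derive_inverse l0; last exact: near_eq_is_derive dg.
- have : \forall x \near u, x \in `]0, 1[ by apply: near_in_itvoo; rewrite in_itv/= u0.
  by apply: filterS => x; rewrite in_itv/= => /andP[x0 x1]; rewrite FK// !ltW.
- have : \forall x \near u, x \in `]0, 1[ by apply: near_in_itvoo; rewrite in_itv/= u0.
  apply: filterS => x x01.
  by have [/(_ x x01)] := (continuous_within_itvP (G b) ltr01).1 G_continuous.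
Qed.

(** Reciprocal slope of the upper branch of [G b] at [u]. It is a function of [u = F b x] rather
    than of [x], in view of the substitution in the integrals. *)
Definition density_upper (u : R) : R :=
  (expR (1 - b) - expR (- b) * expR ((1 - u) * expR (- b)))^-1.

(** Strictness has two sources: [u > 0] when [b = 0], and [1 - b < 1] when [b > 0]. For [b = 0] and
    [u = 0] the slope vanishes. *)
Lemma slope_upper_gt0 u : c <= u -> 0 < u ->
  0 < expR (1 - b) - expR (- b) * expR ((1 - u) * expR (- b)).
Proof.
move=> cu u0; rewrite expRD mulrC -mulrBr mulr_gt0 ?expR_gt0// subr_gt0 ltr_expR.
move: b0; rewrite le_eqVlt => /predU1P[<-|b0'].
  by rewrite oppr0 expR0 mulr1 gtrBl.
by apply: (le_lt_trans (upper_arg_le cu)); rewrite gtrBl.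
Qed.

Lemma is_derive_F_lower x : 0 < x < k -> is_derive x 1 (F b) (expR (b - 1)).
Proof.
move=> /andP[x0 xk]; have k1 := breakvalue_le1.
have x01 : 0 <= x <= 1 by apply/andP; split; lra.
have Fc : F b x < c by rewrite -F_breakvalue F_mono_lt// breakvalue_ge0.
have F0x : 0 < F b x by rewrite -F0 F_mono_lt// lexx ler01.
have F1x : F b x < 1 by rewrite -F1 F_mono_lt ?lexx ?ler01//; lra.
rewrite -[X in is_derive X]GK// -(opprB 1 b) expRN.
apply: (@is_derive_F_branch (fun y => y * expR (1 - b)));
  last by rewrite gt_eqF ?expR_gt0.
- by rewrite F0x.
- by near=> y; rewrite G_lower// ltW//; near: y; exact: lt_nbhsl.
- by apply: is_derive_eq; rewrite /GRing.scale/=; ring.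
Unshelve. all: by end_near. Qed.

Lemma is_derive_F_upper x : k < x < 1 ->
  is_derive x 1 (F b) (density_upper (F b x)).
Proof.
move=> /andP[kx x1]; have k0 := breakvalue_ge0; have k1 := breakvalue_le1.
have x01 : 0 <= x <= 1 by apply/andP; split; lra.
have Fc : c < F b x by rewrite -F_breakvalue F_mono_lt// breakvalue_ge0.
have F0x : 0 < F b x by apply: le_lt_trans Fc; exact: breakpoint_ge0.
have F1x : F b x < 1 by rewrite -F1 F_mono_lt ?lexx ?ler01//; lra.
rewrite -[X in is_derive X]GK//.
apply: (@is_derive_F_branch (fun y => upper ((1 - y) * expR (- b)))).
- by rewrite F0x.
- by near=> y; rewrite G_upper// ltW//; near: y; exact: lt_nbhsr.
- have d : is_derive (F b x) 1 (fun y : R => (1 - y) * expR (- b)) (- expR (- b)).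
    by apply: is_derive_eq; rewrite /GRing.scale/=; ring.
  rewrite -[fun y => _]/(@upper R \o (fun y => (1 - y) * expR (- b))).
  apply: is_derive_eq (is_derive1_comp (is_derive_upper _) d) _.
  by rewrite (expRD 1); ring.
- by rewrite gt_eqF// slope_upper_gt0// ltW.
Unshelve. all: by end_near. Qed.

Lemma f_lower x : 0 < x < k -> f b x = expR (b - 1).
Proof. by move=> /is_derive_F_lower d; rewrite /f derive1E derive_val. Qed.

Lemma f_upper x : k < x < 1 -> f b x = density_upper (F b x).
Proof. by move=> /is_derive_F_upper d; rewrite /f derive1E derive_val. Qed.

End distribution_function.

(** * Integrals against the density [f b] *)

Section integrals.
Variables (R : realType) (b : R).
Hypothesis b01 : 0 <= b <= 1.
Local Notation c := (breakpoint b).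
Local Notation k := (breakvalue b).
Local Notation mu := (@lebesgue_measure R).

Lemma F_continuous_itv (x y : R) : 0 <= x -> x < y -> y <= 1 ->
  [/\ {in `]x, y[, continuous (F b)},
      F b z @[z --> x^'+] --> F b x & F b z @[z --> y^'-] --> F b y].
Proof.
move=> x0 xy y1; apply/continuous_within_itvP => //.
apply: continuous_subspaceW (F_continuous b01).
by move=> z /=; rewrite !in_itv/= => /andP[xz zy]; apply/andP; split; lra.
Qed.

(** Substitution [u = F b z]: by the chain rule [Psi \o F b] is a primitive of the integrand. *)
Lemma integral_f_branch (g psi Psi : R -> R) (x y : R) :
  0 <= x -> x <= y -> y <= 1 ->
  (forall z, x < z < y -> is_derive z 1 (F b) (g (F b z))) ->
  (forall u, F b x <= u <= F b y -> {for u, continuous g}) ->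
  (forall u : R, is_derive u 1 Psi (psi u)) -> continuous psi ->
  (\int[mu]_(z in `]x, y[) (f b z * psi (F b z))%:E =
   (Psi (F b y) - Psi (F b x))%:E)%E.
Proof.
move=> x0; rewrite le_eqVlt => /predU1P[<- _ _ _ _ _|xy y1 dF cg dPsi cpsi].
  by rewrite set_itvoo0 integral_set0 subrr.
have [cF cFx cFy] := F_continuous_itv x0 xy y1.
have cPsi := derivable1_continuous dPsi.
pose gpsi u := g u * psi u.
have Fin z : x <= z <= y -> F b x <= F b z <= F b y.
  by move=> /andP[xz zy]; rewrite !F_mono//; apply/andP; split; lra.
have cgpsi z : x <= z <= y -> {for F b z, continuous gpsi}.
  by move=> /Fin/cg cgz; apply: cvgM => //; exact: cpsi.
have fE z : x < z < y -> f b z = g (F b z).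
  by move=> /dF d; rewrite /f derive1E derive_val.
under eq_integral => z.
  rewrite inE/= in_itv/= => /fE ->.
  over.
(* This function extends the integrand continuously to both ends, where [f b] itself may be
   arbitrary. *)
have cgF : {within `[x, y], continuous (gpsi \o F b)}.
  apply/continuous_within_itvP => //; split.
  - move=> z zxy; apply: continuous_comp; first exact: cF.
    by apply: cgpsi; move: zxy; rewrite in_itv/= => /andP[xz zy]; rewrite !ltW.
  - by apply: cvg_comp cFx _; apply: cgpsi; rewrite lexx ltW.
  - by apply: cvg_comp cFy _; apply: cgpsi; rewrite lexx ltW.
rewrite -(integral_itv_bndoo true false); last first.
  apply/measurable_EFinP; apply: open_continuous_measurable_fun.
    exact: interval_open.
  by move=> z; rewrite inE/=; have [+ _ _] := (continuous_within_itvP _ xy).1 cgF; apply.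
rewrite (@continuous_FTC2 _ (gpsi \o F b) (Psi \o F b))//.
- split=> [z||].
  + rewrite in_itv/= => /dF d.
    by have [] := is_derive1_comp (dPsi _) d.
  + exact: cvg_comp cFx (cPsi _).
  + exact: cvg_comp cFy (cPsi _).
- move=> z; rewrite in_itv/= => /dF d; rewrite derive1E.
  by have d' := is_derive1_comp (dPsi _) d; rewrite derive_val /gpsi/= mulrC.
Qed.

Lemma density_upper_continuous u : c <= u -> 0 < u ->
  {for u, continuous (density_upper b)}.
Proof.
move=> cu u0; apply: cvgV; first by rewrite gt_eqF// slope_upper_gt0.
apply: cvgB; first exact: cvg_cst.
apply: cvgM; first exact: cvg_cst.
apply: (cvg_comp (fun u => (1 - u) * expR (- b)) expR); last exact: continuous_expR.
by apply: cvgM; [apply: cvgB; [exact: cvg_cst|exact: cvg_id]|exact: cvg_cst].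
Qed.

Lemma integral_f_lower (psi Psi : R -> R) (x y : R) :
  0 <= x -> x <= y -> y <= k ->
  (forall u : R, is_derive u 1 Psi (psi u)) -> continuous psi ->
  (\int[mu]_(z in `]x, y[) (f b z * psi (F b z))%:E =
   (Psi (F b y) - Psi (F b x))%:E)%E.
Proof.
move=> x0 xy yk; apply: (@integral_f_branch (cst (expR (b - 1)))) => //.
- exact: le_trans (breakvalue_le1 b01).
- by move=> z /andP[xz zy]; apply: is_derive_F_lower => //; apply/andP; split; lra.
- by move=> u _; exact: cvg_cst.
Qed.

(** The condition [0 < x] keeps [F b] positive, away from the vanishing slope that occurs when
    [b = 0]. *)
Lemma integral_f_upper (psi Psi : R -> R) (x y : R) :
  0 < x -> k <= x -> x <= y -> y <= 1 ->
  (forall u : R, is_derive u 1 Psi (psi u)) -> continuous psi ->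
  (\int[mu]_(z in `]x, y[) (f b z * psi (F b z))%:E =
   (Psi (F b y) - Psi (F b x))%:E)%E.
Proof.
move=> x0 kx xy y1; have x1 : 0 <= x <= 1 by apply/andP; split; lra.
apply: (@integral_f_branch (density_upper b)) => //.
- exact: ltW.
- by move=> z /andP[xz zy]; apply: is_derive_F_upper => //; apply/andP; split; lra.
- move=> u /andP[xu _]; apply: density_upper_continuous.
    apply: le_trans xu; rewrite -(F_breakvalue b01) F_mono//.
    by rewrite (breakvalue_ge0 b01) (breakvalue_le1 b01).
  by apply: lt_le_trans xu; rewrite -(F0 b01) F_mono_lt ?lexx ?ler01.
Qed.

(** The points of [0, 1] at which [F b] is differentiated by a branch formula; at most three points
    are missing. *)
Definition regular_set : set R := `]0, k[%classic `|` `]k, 1[%classic.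
Local Notation D := regular_set.

Lemma f_gt0 x : D x -> 0 < f b x.
Proof.
have [k0 k1] := (breakvalue_ge0 b01, breakvalue_le1 b01).
case; rewrite /= in_itv/= => xD; first by rewrite f_lower ?expR_gt0.
have /andP[kx x1] := xD; have x01 : 0 <= x <= 1 by apply/andP; split; lra.
rewrite f_upper// invr_gt0 slope_upper_gt0//.
  by rewrite -(F_breakvalue b01) F_mono ?k0 ?k1// ltW.
by rewrite -(F0 b01) F_mono_lt ?lexx ?ler01//; lra.
Qed.

Lemma measurable_regular_set : measurable D.
Proof. by apply: measurableU; exact: measurable_itv. Qed.

Lemma measurable_f : measurable_fun D (f b).
Proof.
have [k0 k1] := (breakvalue_ge0 b01, breakvalue_le1 b01).
apply/measurable_funU; [exact: measurable_itv..|split].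
  apply: (@eq_measurable_fun _ _ _ _ _ (cst (expR (b - 1)))) => //.
  by move=> x; rewrite inE/= in_itv/= => /f_lower ->.
apply: (@eq_measurable_fun _ _ _ _ _ (density_upper b \o F b)).
  by move=> x; rewrite inE/= in_itv/= => /f_upper ->.
apply: open_continuous_measurable_fun; first exact: interval_open.
move=> x; rewrite inE/= => xk1.
have k1' : k < 1 by move: xk1; rewrite in_itv/= => /andP[]; exact: lt_trans.
have [cF _ _] := F_continuous_itv k0 k1' (lexx 1).
apply: continuous_comp; first exact: cF.
move: xk1; rewrite in_itv/= => /andP[kx x1].
have x01 : 0 <= x <= 1 by apply/andP; split; lra.
apply: density_upper_continuous.
  by rewrite -(F_breakvalue b01) F_mono ?k0 ?k1// ltW.
by rewrite -(F0 b01) F_mono_lt ?lexx ?ler01//; lra.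
Qed.

Lemma regular_setE x : 0 < x < 1 -> x != k -> D x.
Proof.
move=> /andP[x0 x1]; rewrite neq_lt => /orP[xk|kx]; [left|right];
  by rewrite /= in_itv/= ?x0 ?x1 ?andbT ?xk ?kx.
Qed.

Lemma regular_set_itv x : D x -> 0 < x < 1.
Proof.
have [k0 k1] := (breakvalue_ge0 b01, breakvalue_le1 b01).
by case; rewrite /= in_itv/= => /andP[? ?]; apply/andP; split; lra.
Qed.

Lemma irregular_sub : (`[0, 1]%classic : set R) `\` D `<=` [set 0; k; 1].
Proof.
move=> x /= [+ xD]; rewrite in_itv/= => /andP[].
rewrite le_eqVlt => /predU1P[<-|x0]; first by left; left.
rewrite le_eqVlt => /predU1P[->|x1]; first by right.
have [->|xk] := eqVneq x k; first by left; right.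
by exfalso; apply: xD; apply: regular_setE => //; rewrite x0.
Qed.

Lemma lebesgue_irregular : mu (`[0, 1]%classic `\` D) = 0.
Proof.
apply/eqP; rewrite -measure_le0.
have m3 : measurable ([set 0; k; 1] : set R).
  by apply: measurableU => //; apply: measurableU.
apply: (@le_trans _ _ (mu [set 0; k; 1])).
  apply: le_measure; rewrite ?inE//.
    by apply: measurableD => //; exact: measurable_regular_set.
  exact: irregular_sub.
have -> : mu [set 0; k; 1] = 0%E.
  apply: countable_lebesgue_measure0; apply: finite_set_countable.
  by rewrite !finite_setU; do !split; exact: finite_set1.
by [].
Qed.

(** The finitely many exceptional points are harmless: any function is measurable on a singleton. *)
Lemma measurable_f01 : measurable_fun (`[0, 1]%classic : set R) (f b).
Proof.
have m01 : measurable ((`[0, 1]%classic : set R) `\` D).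
  by apply: measurableD => //; exact: measurable_regular_set.
have -> : (`[0, 1]%classic : set R) = D `|` (`[0, 1] `\` D).
  apply/seteqP; split=> x /=.
    by move=> x01; have [|] := pselect (D x); [left|right].
  by case=> [/regular_set_itv/andP[x0 x1]|[]//]; rewrite in_itv/= !ltW.
apply/measurable_funU => //; first exact: measurable_regular_set.
split; first exact: measurable_f.
have m3 : measurable ([set 0; k; 1] : set R).
  by apply: measurableU => //; apply: measurableU.
apply: (measurable_funS m3 irregular_sub).
apply/measurable_funU => //; first exact: measurableU.
split; last exact: measurable_fun_set1.
by apply/measurable_funU => //; split; exact: measurable_fun_set1.
Qed.

Lemma integral_f_split (g : R -> \bar R) (x y z : R) : x <= y -> y <= z ->
  measurable_fun (`]x, z[%classic : set R) g -> (forall u, x < u < z -> (0 <= g u)%E) ->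
  (\int[mu]_(u in `]x, z[) g u =
   \int[mu]_(u in `]x, y[) g u + \int[mu]_(u in `]y, z[) g u)%E.
Proof.
rewrite le_eqVlt => /predU1P[->|xy]; first by rewrite set_itvoo0 integral_set0 add0e.
rewrite le_eqVlt => /predU1P[->|yz] mg g0.
  by rewrite set_itvoo0 integral_set0 adde0.
have s1 : `]x, y[ `<=` `]x, z[.
  by move=> u; rewrite /= !in_itv/= => /andP[? ?]; apply/andP; split; lra.
rewrite (integral_itv_bndo_bndc (measurable_funS _ s1 mg))//.
have -> : `]x, z[%classic = `]x, y] `|` `]y, z[.
  by rewrite -itv_bndbnd_setU// bnd_simp// ltW.
rewrite ge0_integral_setU//.
- by rewrite -itv_bndbnd_setU// bnd_simp// ltW.
- by rewrite -itv_bndbnd_setU ?bnd_simp// ?ltW// => u; rewrite /= in_itv/=; exact: g0.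
- apply/disj_setPS => u [] /=; rewrite !in_itv/= => /andP[_ uy] /andP[yu _].
  by move: (lt_le_trans yu uy); rewrite ltxx.
Qed.

(** The alternative rules out only [x = 0] with break value 0, where the integral would start at the
    singularity of the density. *)
Lemma integral_f_tail (x : R) : 0 <= x <= 1 -> 0 < x \/ 0 < k ->
  (\int[mu]_(z in D `&` [set z | (x < z)%R]) (f b z)%:E = (1 - F b x)%:E)%E.
Proof.
move=> /andP[x0 x1] xk0.
have [k0 k1] := (breakvalue_ge0 b01, breakvalue_le1 b01).
have did (u : R) : is_derive u 1 id (cst 1 u) by exact: is_derive_id.
have cid : continuous (cst 1 : R -> R) by move=> u; exact: cvg_cst.
have E0 (A : set R) : (\int[mu]_(z in A) (f b z)%:E =
    \int[mu]_(z in A) (f b z * cst 1 (F b z))%:E)%E.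
  by apply: eq_integral => z _; rewrite mulr1.
have [kx|xk] := leP k x.
  have -> : D `&` [set z | x < z] = `]x, 1[%classic.
    apply/seteqP; split=> z /=.
      by move=> [/regular_set_itv/andP[_ z1] xz]; rewrite in_itv/= xz.
    rewrite in_itv/= => /andP[xz z1]; split=> //.
    by right; rewrite /= in_itv/= z1 andbT (le_lt_trans kx).
  rewrite E0 (integral_f_upper _ kx _ _ did)//; first by rewrite F1.
  by case: xk0 => // k0'; exact: lt_le_trans kx.
have -> : D `&` [set z | x < z] = `]x, k[ `|` `]k, 1[.
  apply/seteqP; split=> z /=.
    by move=> [[]/=]; rewrite !in_itv/= => /andP[? ?] xz; [left|right]; apply/andP.
  rewrite !in_itv/= => -[/andP[xz zk]|/andP[kz z1]].
    by split=> //; left; rewrite /= in_itv/= zk (le_lt_trans x0).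
  by split; [right; rewrite /= in_itv/= kz|exact: lt_trans kz].
have sub : `]x, k[ `|` `]k, 1[ `<=` D.
  move=> z [H|zk]; [left|by right].
  by move: H; rewrite /= !in_itv/= => /andP[xz ->]; rewrite (le_lt_trans x0).
rewrite ge0_integral_setU//=.
- rewrite !E0 (integral_f_lower x0 _ _ did)//; last exact: ltW.
  rewrite (integral_f_upper _ _ _ _ did)//; last exact: le_lt_trans xk.
  by rewrite F1// -EFinD; congr EFin; ring.
- by apply/measurable_EFinP; exact: measurable_funS measurable_regular_set sub measurable_f.
- by move=> z /sub/f_gt0/ltW; rewrite lee_fin.
- apply/disj_setPS => u [] /=; rewrite !in_itv/= => /andP[_ uy] /andP[yu _].
  by move: (lt_trans yu uy); rewrite ltxx.
Qed.

Lemma measurable_F : measurable_fun (`]0, 1[%classic : set R) (F b).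
Proof.
apply: open_continuous_measurable_fun; first exact: interval_open.
move=> x; rewrite inE/= => x01.
by have [cF _ _] := F_continuous_itv (lexx 0) ltr01 (lexx 1); exact: cF.
Qed.

End integrals.

(** * From the law of the vector to integrals in one variable *)

(** The factors are known to be measurable and nonnegative on [D1] and [D2] only, so the integrand
    is extended by zero before Tonelli's theorem is applied. *)
Lemma tonelli_setX d1 d2 (T1 : measurableType d1) (T2 : measurableType d2)
    (R : realType) (m1 : {sigma_finite_measure set T1 -> \bar R})
    (m2 : {sigma_finite_measure set T2 -> \bar R})
    (D1 : set T1) (D2 : set T2) (g1 : T1 -> R) (g2 : T2 -> R) (A : set (T1 * T2)) :
  measurable D1 -> measurable D2 -> measurable A ->
  measurable_fun D1 g1 -> measurable_fun D2 g2 ->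
  (forall x, D1 x -> 0 <= g1 x) -> (forall y, D2 y -> 0 <= g2 y) ->
  (\int[m1 \x m2]_(z in A `&` D1 `*` D2) (g1 z.1 * g2 z.2)%:E =
   \int[m1]_(x in D1) ((g1 x)%:E * \int[m2]_(y in D2 `&` xsection A x) (g2 y)%:E))%E.
Proof.
move=> mD1 mD2 mA mg1 mg2 g10 g20.
have mD : measurable (D1 `*` D2) by exact: measurableX.
have mAD : measurable (A `&` D1 `*` D2) by exact: measurableI.
rewrite integral_mkcond fubini_tonelli1//; last 2 first.
- apply/(measurable_restrictT _ _).1 => //; apply/measurable_EFinP.
  apply: (@measurable_funS _ _ _ _ (D1 `*` D2)) => //.
  apply: measurable_funM.
  + apply: (measurable_comp mD1 _ mg1); last exact: measurable_funTS.
    by move=> _ [z [zD1 _] <-].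
  + apply: (measurable_comp mD2 _ mg2); last exact: measurable_funTS.
    by move=> _ [z [_ zD2] <-].
- move=> z; apply: erestrict_ge0 => {}z [_ [z1 z2]].
  by rewrite lee_fin mulr_ge0 ?g10 ?g20.
rewrite [RHS]integral_mkcond; apply: eq_integral => x _.
rewrite /fubini_F patchE; case: ifPn => [|] xD1.
  have {}xD1 : D1 x by exact: set_mem xD1.
  have mDA : measurable (D2 `&` xsection A x).
    by apply: measurableI => //; exact: measurable_xsection.
  rewrite -ge0_integralZl_EFin//; last 3 first.
  - by move=> y [/g20].
  - by apply/measurable_EFinP; apply: measurable_funS mg2 => // y [].
  - exact: g10.
  rewrite [RHS]integral_mkcond; apply: eq_integral => y _.
  rewrite !patchE; case: ifPn => [|] yA.
    rewrite mem_set ?EFinM//; have [Axy [_ D2y]] := set_mem yA.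
    by split=> //; rewrite /xsection/= inE.
  rewrite memNset// => -[D2y]; rewrite /xsection/= inE => Axy.
  by move/negP: yA; apply; rewrite inE.
apply: integral0_eq => y _; rewrite patchE memNset// => -[_ [/= D1x _]].
by move/negP: xD1; apply; rewrite inE.
Qed.

Section law.
Variables (R : realType) (d : measure_display) (T : measurableType d).
Variables (P : probability T R) (Sigma : {RV P >-> (R * R)%type}) (b1 b2 : R).
Hypotheses (b1_01 : 0 <= b1 <= 1) (b2_01 : 0 <= b2 <= 1).
Hypothesis density : has_density_f Sigma b1 b2.
Local Notation mu := (@lebesgue_measure R).
Local Notation I01 := (`[0%R, 1%R]%classic : set R).
Local Notation D1 := (regular_set b1).
Local Notation D2 := (regular_set b2).

Lemma lebesgue_irregular2 :
  (mu \x mu)%E ((I01 `*` I01) `\` D1 `*` D2) = 0%E.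
Proof.
have mD1 := measurable_regular_set b1; have mD2 := measurable_regular_set b2.
have m1 : measurable ((I01 `\` D1) `*` I01 : set (R * R)).
  by apply: measurableX => //; exact: measurableD.
have m2 : measurable (I01 `*` (I01 `\` D2) : set (R * R)).
  by apply: measurableX => //; exact: measurableD.
apply/eqP; rewrite -measure_le0.
apply: (@le_trans _ _ ((mu \x mu)%E (((I01 `\` D1) `*` I01)
    `|` (I01 `*` (I01 `\` D2))))).
  apply: le_measure; rewrite ?inE.
  - by apply: measurableD; apply: measurableX.
  - exact: measurableU.
  - move=> [x y] [[/= x01 y01] nD].
    have [xD1|xD1] := pselect (D1 x); last by left.
    by right; split=> //; split=> // yD2; apply: nD.
apply: (le_trans (measureU2 _ _ _)) => //.
have mI : measurable I01 by [].
have e1 : ((mu \x mu)%E ((I01 `\` D1) `*` I01) <= 0)%E.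
  rewrite (product_measure1E mu mu (measurableD mI mD1) mI).
  by rewrite [X in (X * _)%E](lebesgue_irregular b1) mul0e.
have e2 : ((mu \x mu)%E (I01 `*` (I01 `\` D2)) <= 0)%E.
  rewrite (product_measure1E mu mu mI (measurableD mI mD2)).
  by rewrite [X in (_ * X)%E](lebesgue_irregular b2) mule0.
by rewrite -[leRHS]adde0; exact: leeD e1 e2.
Qed.

(** [A] is cut along [D1 * D2]. The piece outside meets the square in a null set and contributes
    nothing, whatever the values of the densities there; Tonelli's theorem handles the other
    piece. *)
Lemma law_integral (A : set (R * R)) : measurable A ->
  (P (Sigma @^-1` A) =
   \int[mu]_(x in D1) ((f b1 x)%:E *
     \int[mu]_(y in D2 `&` xsection A x) (f b2 y)%:E))%E.
Proof.
move=> mA; have mD1 := measurable_regular_set b1; have mD2 := measurable_regular_set b2.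
rewrite -tonelli_setX//; first last.
- by move=> y /(f_gt0 b2_01)/ltW.
- by move=> x /(f_gt0 b1_01)/ltW.
- exact: measurable_f.
- exact: measurable_f.
have mD : measurable (D1 `*` D2) by exact: measurableX.
have mU : measurable (I01 `*` I01 : set (R * R)).
  exact: measurableX.
have -> : P (Sigma @^-1` A) = (distribution P Sigma (A `\` D1 `*` D2) +
    distribution P Sigma (A `&` D1 `*` D2))%E.
  exact: (measureDI (distribution P Sigma) mA mD).
rewrite !density//; [|exact: measurableI|exact: measurableD].
rewrite null_set_integral ?add0e//.
  + by congr (integral _ _ _); apply/seteqP; split=> [z []//|z [Az Dz]]; split=> //;
      case: Dz => /(regular_set_itv b1_01)/andP[? ?] /(regular_set_itv b2_01)/andP[? ?];
      split; rewrite /= in_itv/= !ltW.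
  + by apply: measurableI => //; exact: measurableD.
  + apply/measurable_EFinP; apply: (@measurable_funS _ _ _ _ (I01 `*` I01)) => //.
    apply: measurable_funM.
    * apply: (measurable_comp _ _ (measurable_f01 b1_01)) => //; last exact: measurable_funTS.
      by move=> _ [z [zD1 _] <-].
    * apply: (measurable_comp _ _ (measurable_f01 b2_01)) => //; last exact: measurable_funTS.
      by move=> _ [z [_ zD2] <-].
  + apply/eqP; rewrite -measure_le0 -lebesgue_irregular2.
    apply: le_measure; rewrite ?inE.
    * by apply: measurableI => //; exact: measurableD.
    * exact: measurableD.
    * by move=> z [[Az nD] zU].
Qed.

Lemma measurable_ltset : measurable [set z : R * R | z.1 < z.2].
Proof.
rewrite -[X in measurable X]setTI.
have := @measurable_fun_ltr _ _ R setT (@fst R R) (@snd R R)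
  measurable_fst measurable_snd.
by move=> /(_ measurableT [set true] I).
Qed.

Lemma prob_lt :
  (P [set w | ((Sigma w).1 < (Sigma w).2)%R] =
   \int[mu]_(x in D1) (f b1 x * (1 - F b2 x))%:E)%E.
Proof.
rewrite -[X in P X]/(Sigma @^-1` [set z | z.1 < z.2]) law_integral;
  last exact: measurable_ltset.
apply: eq_integral => x; rewrite inE => /(regular_set_itv b1_01)/andP[x0 x1].
rewrite EFinM -integral_f_tail//; [|by rewrite !ltW|by left].
congr (_ * integral _ _ _)%E; apply/seteqP; split=> y [D2y];
  by rewrite /xsection/= ?inE.
Qed.

(** The normalization comes from [P] having mass 1, so it also covers [b1 = 0], where
    [integral_f_tail] cannot start at 0. *)
Lemma total_mass : 0 < breakvalue b2 -> (\int[mu]_(x in D1) (f b1 x)%:E = 1)%E.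
Proof.
move=> k2; rewrite -(probability_setT P) -(preimage_setT Sigma) law_integral//.
apply: eq_integral => x _.
have -> : D2 `&` xsection setT x = D2 `&` [set z | 0 < z].
  apply/seteqP; split=> y [D2y _]; split=> //; last by rewrite /xsection/= inE.
  by have /andP[] := regular_set_itv b2_01 D2y.
by rewrite integral_f_tail ?lexx ?ler01 ?F0 ?subr0 ?mule1//; right.
Qed.

End law.

Lemma integral_regular_split (R : realType) (b y : R) (g : R -> \bar R) :
  0 <= b <= 1 -> breakvalue b <= y <= 1 ->
  measurable_fun (regular_set b) g ->
  (forall x, regular_set b x -> (0 <= g x)%E) ->
  (\int[lebesgue_measure]_(x in regular_set b) g x =
   \int[lebesgue_measure]_(x in `]0%R, breakvalue b[) g x +
   (\int[lebesgue_measure]_(x in `]breakvalue b, y[) g x +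
    \int[lebesgue_measure]_(x in `]y, 1%R[) g x))%E.
Proof.
move=> b01 /andP[ky y1] mg g0; rewrite -integral_f_split//.
- rewrite /regular_set ge0_integral_setU//; apply/disj_setPS => u [] /=.
  rewrite !in_itv/= => /andP[_ uy] /andP[yu _].
  by move: (lt_trans yu uy); rewrite ltxx.
- by apply: measurable_funS mg; [exact: measurable_regular_set|right].
- by move=> u ku; apply: g0; right; rewrite /= in_itv.
Qed.

Lemma breakvalue_incr (R : realType) (b1 b2 : R) : 0 <= b1 -> b1 < b2 ->
  breakvalue b1 < breakvalue b2.
Proof. by move=> b10 b12; apply: upper_decr; lra. Qed.

(** * Two parameters [b1 < b2] *)

Section comparison.
Variables (R : realType) (b1 b2 : R).
Hypotheses (b1_01 : 0 <= b1 <= 1) (b2_01 : 0 <= b2 <= 1) (b12 : b1 < b2).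
Local Notation r := (expR (b2 - b1)).
Local Notation c1 := (breakpoint b1).
Local Notation k1 := (breakvalue b1).
Local Notation c2 := (breakpoint b2).
Local Notation k2 := (breakvalue b2).

Let k12 : k1 < k2.
Proof. by have /andP[? _] := b1_01; exact: breakvalue_incr. Qed.

(** Up to [k1] both functions invert a linear branch, and the slopes have quotient [r]. *)
Lemma F_lower_ratio x : 0 <= x <= k1 -> F b2 x = r * F b1 x.
Proof.
move=> /andP[x0 xk].
have x01 : 0 <= x <= 1 by rewrite x0 (le_trans xk)// breakvalue_le1.
have k01 : 0 <= k1 <= 1 by rewrite breakvalue_ge0 ?breakvalue_le1.
have uc : F b1 x <= c1 by rewrite -(F_breakvalue b1_01) F_mono.
have rE : r * expR (1 - b2) = expR (1 - b1) by rewrite -expRD; congr expR; ring.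
have rc : r * F b1 x <= c2.
  rewrite -(ler_pM2r (expR_gt0 (1 - b2))) -breakvalueE mulrAC rE.
  by rewrite mulrC -(G_lower uc) GK// (le_trans xk)// ltW.
have xE : x = G b2 (r * F b1 x).
  by rewrite (G_lower rc) mulrAC rE mulrC -(G_lower uc) GK.
rewrite {1}xE FK// mulr_ge0 ?expR_ge0 ?F_ge0//=.
exact: le_trans rc (breakpoint_le1 b2_01).
Qed.

Lemma F_upper_ratio x : k2 <= x <= 1 -> 1 - F b2 x = r * (1 - F b1 x).
Proof.
move=> /andP[kx x1].
have k201 : 0 <= k2 <= 1 by rewrite breakvalue_ge0 ?breakvalue_le1.
have k101 : 0 <= k1 <= 1 by rewrite breakvalue_ge0 ?breakvalue_le1.
have x01 : 0 <= x <= 1 by have /andP[k0 _] := k201; rewrite x1 (le_trans k0).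
have uc : c1 <= F b1 x.
  by rewrite -(F_breakvalue b1_01) F_mono// ltW// (lt_le_trans k12).
set u := F b1 x in uc *; pose v := 1 - r * (1 - u).
have u1 : u <= 1 by exact: F_le1.
have xE : x = upper ((1 - u) * expR (- b1)) by rewrite -(G_upper uc) /u GK.
have rb2 : r * expR (- b2) = expR (- b1) by rewrite -expRD; congr expR; ring.
have argE : (1 - v) * expR (- b2) = (1 - u) * expR (- b1).
  by rewrite /v -rb2; ring.
(* The common value of [s] must lie in the upper range of [b2] too; a larger [s] would put [x] below
   [k2]. *)
have le2 : (1 - u) * expR (- b1) <= 1 - b2.
  rewrite leNgt; apply/negP => lt2.
  have : upper ((1 - u) * expR (- b1)) < k2.
    apply: upper_decr lt2 _; apply: (le_trans (upper_arg_le uc)).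
    by have /andP[? _] := b1_01; lra.
  by rewrite -xE ltNge kx.
have vc : c2 <= v.
  rewrite -lerN2 -(lerD2l 1) -(ler_pM2r (expR_gt0 (- b2))) argE.
  by rewrite breakpoint_upper.
have -> : x = G b2 v by rewrite (G_upper vc) argE.
rewrite FK//; first by rewrite /v; ring.
apply/andP; split; first exact: le_trans (breakpoint_ge0 b2_01) vc.
by rewrite /v gerBl mulr_ge0 ?expR_ge0// subr_ge0.
Qed.

Lemma F_breakvalue2 : 1 - F b1 k2 = (1 - b2) * expR b1.
Proof.
have k201 : k2 <= k2 <= 1 by rewrite lexx breakvalue_le1.
have := F_upper_ratio k201; rewrite F_breakvalue// /breakpoint /upper_width => e.
have r0 : r != 0 by rewrite gt_eqF ?expR_gt0.
apply: (mulfI r0); rewrite -e.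
have -> : expR b2 = r * expR b1 by rewrite -expRD; congr expR; ring.
by ring.
Qed.

Variables (d : measure_display) (T : measurableType d).
Variables (P : probability T R) (Sigma : {RV P >-> (R * R)%type}).
Hypothesis density : has_density_f Sigma b1 b2.
Local Notation mu := (@lebesgue_measure R).
Local Notation D1 := (regular_set b1).

Let k1_01 : 0 <= k1 <= 1. Proof. by rewrite breakvalue_ge0 ?breakvalue_le1. Qed.
Let k2_01 : 0 <= k2 <= 1. Proof. by rewrite breakvalue_ge0 ?breakvalue_le1. Qed.
Let k2_gt0 : 0 < k2. Proof. by apply: le_lt_trans k12; case/andP: k1_01. Qed.
Let k1k2 : k1 <= k2 <= 1. Proof. by rewrite (ltW k12); case/andP: k2_01. Qed.

Let did (u : R) : is_derive u 1 id (cst 1 u).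
Proof. exact: is_derive_id. Qed.

Let cid : continuous (cst 1 : R -> R).
Proof. by move=> u; exact: cvg_cst. Qed.

Let integral_f1 (A : set R) :
  (\int[mu]_(z in A) (f b1 z)%:E = \int[mu]_(z in A) (f b1 z * cst 1 (F b1 z))%:E)%E.
Proof. by apply: eq_integral => z _; rewrite mulr1. Qed.

(** What remains of the total mass after removing [c1] on the left and [(1 - b2) * expR b1] on the
    right. A direct evaluation would meet the singular end when [b1 = 0]. *)
Lemma middle_mass :
  (\int[mu]_(x in `]k1, k2[) (f b1 x)%:E =
   ((b2 - b1) * expR b1)%:E)%E.
Proof.
have /andP[k10 k11] := k1_01; have /andP[_ k21] := k2_01.
have := total_mass b1_01 b2_01 density k2_gt0.
rewrite (integral_regular_split b1_01 k1k2); last 2 first.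
- by apply/measurable_EFinP; exact: measurable_f.
- by move=> x /(f_gt0 b1_01)/ltW; rewrite lee_fin.
rewrite [X in (X + _)%E]integral_f1.
rewrite (integral_f_lower b1_01 (lexx 0) k10 (lexx k1) did cid).
rewrite [X in (_ + (_ + X))%E]integral_f1.
rewrite (integral_f_upper b1_01 k2_gt0 (ltW k12) k21 (lexx 1) did cid).
rewrite F0// F1// F_breakvalue// F_breakvalue2 subr0.
case: (\int[mu]_(x in _) _)%E => [m||]//.
rewrite -!EFinD => -[e]; congr EFin; move: e; rewrite /breakpoint /upper_width.
by move=> e; lra.
Qed.

Let tail_integrand x := (f b1 x * (1 - F b2 x))%:E.

Let measurable_tail : measurable_fun D1 tail_integrand.
Proof.
apply/measurable_EFinP; apply: measurable_funM; first exact: measurable_f.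
apply: measurable_funB; first exact: measurable_cst.
have sub : D1 `<=` `]0, 1[ by move=> z /(regular_set_itv b1_01); rewrite /= in_itv.
by apply: measurable_funS sub (measurable_F b2_01).
Qed.

Let tail_ge0 x : D1 x -> (0 <= tail_integrand x)%E.
Proof.
move=> D1x; rewrite lee_fin mulr_ge0//; first by rewrite ltW// f_gt0.
have /andP[? ?] := regular_set_itv b1_01 D1x.
by rewrite subr_ge0 F_le1// !ltW.
Qed.

(** The real [m] is the contribution of the middle interval, bounded by its mass times the values of
    [1 - F b2] at [k2] and at [k1]. The outer terms are the integrals of [1 - r * u] over [0, c1]
    and of [r * (1 - u)] from [F b1 k2] to 1. *)
Lemma prob_lt_split : exists m : R,
  [/\ P [set w | ((Sigma w).1 < (Sigma w).2)%R] =
      (c1 - r * c1 ^+ 2 / 2 + m + r * ((1 - b2) * expR b1) ^+ 2 / 2)%:E,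
      (b2 - b1) * expR b1 * (r * ((1 - b2) * expR b1)) <= m &
      m <= (b2 - b1) * expR b1 * (1 - r * c1)].
Proof.
have /andP[k10 k11] := k1_01; have /andP[_ k21] := k2_01.
have mitv : measurable (`]k1, k2[%classic : set R) by [].
have sub : (`]k1, k2[%classic : set R) `<=` D1.
  move=> z; rewrite /= in_itv/= => /andP[kz zk]; right.
  by rewrite /= in_itv/= kz (lt_le_trans zk).
have mf : measurable_fun (`]k1, k2[%classic : set R) (fun x => (f b1 x)%:E).
  apply/measurable_EFinP.
  exact: measurable_funS (measurable_regular_set b1) sub (measurable_f b1_01).
have f0 x : `]k1, k2[%classic x -> (0 <= (f b1 x)%:E)%E.
  by move=> /sub/(f_gt0 b1_01)/ltW; rewrite lee_fin.
have mg := measurable_funS (measurable_regular_set b1) sub measurable_tail.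
have Fb x : k1 < x < k2 -> r * ((1 - b2) * expR b1) <= 1 - F b2 x <= 1 - r * c1.
  move=> /andP[kx xk]; have x01 : 0 <= x <= 1 by apply/andP; split; lra.
  rewrite -F_breakvalue2 -F_upper_ratio ?lexx//.
  rewrite -(F_breakvalue b1_01) -F_lower_ratio ?lexx ?k10//.
  by rewrite !lerD2l !lerN2 !F_mono// !ltW.
have lo : (((b2 - b1) * expR b1 * (r * ((1 - b2) * expR b1)))%:E <=
    \int[mu]_(x in `]k1, k2[) tail_integrand x)%E.
  rewrite EFinM -middle_mass muleC -ge0_integralZl_EFin//; last first.
    by rewrite !mulr_ge0 ?expR_ge0// subr_ge0; case/andP: b2_01.
  apply: ge0_le_integral => //.
  - move=> x x12; rewrite mule_ge0 ?f0// lee_fin.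
    by rewrite !mulr_ge0 ?expR_ge0// subr_ge0; case/andP: b2_01.
  - exact: measurable_funeM.
  - move=> x x12; have fx := f0 x x12; move: x12; rewrite /= in_itv/= => /Fb/andP[h _].
    by rewrite -EFinM lee_fin mulrC ler_wpM2l.
have hi : (\int[mu]_(x in `]k1, k2[) tail_integrand x <=
    ((b2 - b1) * expR b1 * (1 - r * c1))%:E)%E.
  have rc1 : 0 <= 1 - r * c1.
    have k1k1 : 0 <= k1 <= k1 by rewrite k10 lexx.
    by rewrite -(F_breakvalue b1_01) -F_lower_ratio// subr_ge0 F_le1.
  rewrite EFinM -middle_mass muleC -ge0_integralZl_EFin//.
  apply: ge0_le_integral => //.
  - by move=> x /sub; exact: tail_ge0.
  - exact: measurable_funeM.
  - move=> x x12; have fx := f0 x x12; move: x12; rewrite /= in_itv/= => /Fb/andP[_ h].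
    by rewrite -EFinM lee_fin mulrC ler_wpM2r.
rewrite (prob_lt b1_01 b2_01 density) (integral_regular_split b1_01 k1k2)//.
have -> : (\int[mu]_(x in `]0%R, k1[) tail_integrand x =
    (c1 - r * c1 ^+ 2 / 2)%:E)%E.
  have dPsi (u : R) : is_derive u 1 (fun u => u - r * u ^+ 2 / 2) (1 - r * u).
    by apply: is_derive_eq; rewrite /GRing.scale/=; field.
  have cpsi : continuous (fun u : R => 1 - r * u).
    by move=> u; apply: cvgB; [exact: cvg_cst|apply: cvgM; [exact: cvg_cst|exact: cvg_id]].
  transitivity (\int[mu]_(x in `]0%R, k1[) (f b1 x * (1 - r * F b1 x))%:E)%E.
    apply: eq_integral => x; rewrite inE/= in_itv/= => /andP[x0 xk].
    by rewrite /tail_integrand F_lower_ratio// !ltW.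
  rewrite (integral_f_lower b1_01 (lexx 0) k10 (lexx k1) dPsi cpsi).
  by rewrite F0// F_breakvalue//; congr EFin; field.
have -> : (\int[mu]_(x in `]k2, 1%R[) tail_integrand x =
    (r * ((1 - b2) * expR b1) ^+ 2 / 2)%:E)%E.
  have dPsi (u : R) : is_derive u 1 (fun u => - (r * (1 - u) ^+ 2 / 2)) (r * (1 - u)).
    by apply: is_derive_eq; rewrite /GRing.scale/=; field.
  have cpsi : continuous (fun u : R => r * (1 - u)).
    by move=> u; apply: cvgM; [exact: cvg_cst|apply: cvgB; [exact: cvg_cst|exact: cvg_id]].
  transitivity (\int[mu]_(x in `]k2, 1%R[) (f b1 x * (r * (1 - F b1 x)))%:E)%E.
    apply: eq_integral => x; rewrite inE/= in_itv/= => /andP[kx x1].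
    by rewrite /tail_integrand F_upper_ratio// !ltW.
  rewrite (integral_f_upper b1_01 k2_gt0 (ltW k12) k21 (lexx 1) dPsi cpsi).
  by rewrite F1// F_breakvalue2; congr EFin; field.
(* The two real bounds exclude infinite values of the middle integral. *)
move: lo hi; case: (\int[mu]_(x in _) tail_integrand x)%E => [m||]//.
rewrite !lee_fin => lo hi; exists m; split=> //.
by rewrite -!EFinD addrA.
Qed.

End comparison.

(** * Comparison with the uniform density of parameter 1 *)

Lemma F_uniform (R : realType) (x : R) : 0 <= x <= 1 -> F 1 x = x.
Proof.
move=> x01; have o1 : 0 <= (1 : R) <= 1 by rewrite ler01 lexx.
rewrite -[X in F 1 X](_ : G 1 x = x) ?FK// G_lower ?subrr ?expR0 ?mulr1//.
by rewrite /breakpoint /upper_width subrr mul0r subr0; case/andP: x01.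
Qed.

Section comparison_uniform.
Variables (R : realType) (b : R).
Hypotheses (b_01 : 0 <= b <= 1).
Local Notation c := (breakpoint b).
Local Notation k := (breakvalue b).
Local Notation mu := (@lebesgue_measure R).
Variables (d : measure_display) (T : measurableType d).
Variables (P : probability T R) (Sigma : {RV P >-> (R * R)%type}).
Hypothesis density : has_density_f Sigma b 1.

Let one_01 : 0 <= (1 : R) <= 1. Proof. by rewrite ler01 lexx. Qed.
Let k0 : 0 <= k. Proof. exact: breakvalue_ge0. Qed.
Let k1 : k <= 1. Proof. exact: breakvalue_le1. Qed.

Lemma prob_lt_uniform :
  (P [set w | ((Sigma w).1 < (Sigma w).2)%R] =
   \int[mu]_(x in regular_set b) (f b x * (1 - x))%:E)%E.
Proof.
rewrite (prob_lt b_01 one_01 density); apply: eq_integral => x.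
by rewrite inE => /(regular_set_itv b_01)/andP[? ?]; rewrite F_uniform// !ltW.
Qed.

(* A primitive of [1 - G b] on the upper branch. *)
Definition primitive_upper (u : R) : R :=
  let s := (1 - u) * expR (- b) in u + expR b * (expR s - expR 1 * s ^+ 2 / 2).

Lemma is_derive_primitive_upper (u : R) :
  is_derive u 1 primitive_upper (1 - upper ((1 - u) * expR (- b))).
Proof.
have ds : is_derive u 1 (fun u : R => (1 - u) * expR (- b)) (- expR (- b)).
  by apply: is_derive_eq; rewrite /GRing.scale/=; ring.
have dg (s : R) : is_derive s 1 (fun s => expR s - expR 1 * s ^+ 2 / 2) (upper s).
  by rewrite /upper; apply: is_derive_eq; rewrite /GRing.scale/=; field.
have dc := is_derive1_comp (dg _) ds.
rewrite /primitive_upper.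
rewrite -[fun u => _]/(id \+ expR b \*: ((fun s => expR s - expR 1 * s ^+ 2 / 2)
  \o (fun u : R => (1 - u) * expR (- b)))).
apply: is_derive_eq; rewrite /GRing.scale/= expRN.
by field; rewrite gt_eqF ?expR_gt0.
Qed.

Lemma integral_upper_uniform (x : R) : 0 < x -> k <= x -> x <= 1 ->
  (\int[mu]_(z in `]x, 1%R[) (f b z * (1 - z))%:E =
   (primitive_upper 1 - primitive_upper (F b x))%:E)%E.
Proof.
move=> x0 kx x1.
have cpsi : continuous (fun u : R => 1 - upper ((1 - u) * expR (- b))).
  move=> u; apply: cvgB; first exact: cvg_cst.
  apply: (cvg_comp (fun u => (1 - u) * expR (- b)) (@upper R)).
    by apply: cvgM; [apply: cvgB; [exact: cvg_cst|exact: cvg_id]|exact: cvg_cst].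
  exact: derivable1_continuous (@is_derive_upper R) _.
rewrite -[in RHS](F1 b_01).
rewrite -(integral_f_upper b_01 x0 kx x1 (lexx 1) is_derive_primitive_upper cpsi).
apply: eq_integral => z; rewrite inE/= in_itv/= => /andP[xz z1].
have z01 : 0 <= z <= 1 by apply/andP; split; lra.
have k01 : 0 <= k <= 1 by rewrite k0 k1.
rewrite -G_upper ?GK//.
by rewrite -(F_breakvalue b_01) F_mono// (le_trans kx)// ltW.
Qed.

Let integrand x := (f b x * (1 - x))%:E.

Let measurable_integrand : measurable_fun (regular_set b) integrand.
Proof.
apply/measurable_EFinP; apply: measurable_funM; first exact: measurable_f.
by apply: measurable_funB; [exact: measurable_cst|exact: measurable_id].
Qed.

Let integrand_ge0 x : regular_set b x -> (0 <= integrand x)%E.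
Proof.
move=> bx; rewrite lee_fin mulr_ge0//; first by rewrite ltW// f_gt0.
by have /andP[_ ?] := regular_set_itv b_01 bx; rewrite subr_ge0 ltW.
Qed.

(** The probability is the mean of [1 - x] under [f b]; with [x = G b u] it becomes the integral of
    [1 - G b u] in [u], taken branch by branch. Since [0 < b] the break value is positive, and the
    upper integral may start there. *)
Lemma prob_lt_uniformE : 0 < b ->
  (P [set w | ((Sigma w).1 < (Sigma w).2)%R] = (1 - E b)%:E)%E.
Proof.
move=> b0; have /andP[_ b1] := b_01.
have k_gt0 : 0 < k.
  have := @breakvalue_incr _ 0 b (lexx 0) b0; apply: le_lt_trans.
  by apply: breakvalue_ge0; rewrite lexx ler01.
have kk1 : k <= k <= 1 by rewrite lexx.
rewrite prob_lt_uniform (integral_regular_split b_01 kk1)//.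
rewrite set_itvoo0 integral_set0 add0e integral_upper_uniform//.
have dPsi (u : R) :
    is_derive u 1 (fun u => u - expR (1 - b) * u ^+ 2 / 2) (1 - u * expR (1 - b)).
  by apply: is_derive_eq; rewrite /GRing.scale/=; field.
have cpsi : continuous (fun u : R => 1 - u * expR (1 - b)).
  by move=> u; apply: cvgB; [exact: cvg_cst|apply: cvgM; [exact: cvg_id|exact: cvg_cst]].
have -> : (\int[mu]_(x in `]0%R, k[) integrand x =
    (c - expR (1 - b) * c ^+ 2 / 2)%:E)%E.
  transitivity (\int[mu]_(x in `]0%R, k[) (f b x * (1 - F b x * expR (1 - b)))%:E)%E.
    apply: eq_integral => x; rewrite inE/= in_itv/= => /andP[x0 xk].
    have x01 : 0 <= x <= 1 by rewrite ltW//= (le_trans _ k1)// ltW.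
    rewrite -G_lower ?GK//.
    by rewrite -(F_breakvalue b_01) F_mono ?k0 ?k1// ltW.
  rewrite (integral_f_lower b_01 (lexx 0) k0 (lexx k) dPsi cpsi).
  by rewrite F0// F_breakvalue//; congr EFin; field.
rewrite -EFinD; congr EFin.
rewrite F_breakvalue// /primitive_upper breakpoint_upper subrr mul0r expR0.
rewrite /E /breakpoint /upper_width.
have -> : expR 1 = expR b * expR (1 - b) by rewrite -expRD; congr expR; ring.
by field.
Qed.

(** Here only a lower bound is taken: the nonnegative integral from 0 to a positive [x] is
    discarded. *)
Lemma prob_lt_uniform0 : b = 0 ->
  ((2^-1)%:E < P [set w | ((Sigma w).1 < (Sigma w).2)%R])%E.
Proof.
move=> b0; have k_0 : k = 0.
  by rewrite breakvalueE /breakpoint /upper_width b0 subr0 mul1r expR0 subrr mul0r.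
(* Cutting at the point where [F b] equals 1/10 loses at most 1/10, while the full value [2 - e / 2]
   exceeds 0.64. *)
pose x := G b 10^-1.
have u01 : 0 <= (10^-1 : R) <= 1 by apply/andP; split; lra.
have x0 : 0 < x by rewrite /x -(G0 b_01) G_incr//; lra.
have x1 : x <= 1 by rewrite /x -[leRHS](G1 b_01) G_le//; lra.
have kx : k <= x by rewrite k_0 ltW.
have kx1 : k <= x <= 1 by rewrite kx x1.
rewrite prob_lt_uniform (integral_regular_split b_01 kx1)//.
rewrite integral_upper_uniform// k_0 set_itvoo0 integral_set0 add0e.
apply: (@lt_le_trans _ _ (primitive_upper 1 - primitive_upper (F b x))%:E); last first.
  rewrite leeDr//; apply: integral_ge0 => z; rewrite /= in_itv/= => /andP[z0 zx].
  by apply: integrand_ge0; right; rewrite /= in_itv/= k_0 z0 (lt_le_trans zx).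
rewrite lte_fin /x FK// /primitive_upper b0 subrr mul0r oppr0 expR0 !mulr1.
have e0 := expR1_le R.
(* From [1 + 1/10 <= expR (1/10)], inverted. *)
have e9 : expR (1 - 10^-1) <= expR 1 * (10 / 11) :> R.
  rewrite expRD expRN ler_wpM2l ?expR_ge0//.
  rewrite (_ : 10 / 11 = (1 + 10^-1)^-1); last by field.
  by rewrite lef_pV2 ?posrE ?expR_gt0//; exact: expR_ge1Dx.
move: e0 e9; move: (expR 1) (expR (1 - 10^-1)) => e e' e0 e9.
by rewrite expr0n/= mulr0 mul0r subr0 !mul1r; lra.
Qed.

End comparison_uniform.

(** * Signs near the diagonal and conclusion *)

(** Let t = b2 - b1, r = e^t, p = e^{b1} and q = [upper_width b1]. The bounds on [m] place 2P - 1
    between (r - 1)(2q - 1) - r p^2 t^2 and (r - 1)(2q - 1) + r p^2 t^2 - 2 t p (r - 1). As r - 1 >=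
    t, the term with 2q - 1 dominates once r p^2 t < |2q - 1|. *)
Lemma prob_lt_near (R : realType) (b1 b2 : R)
    (d : measure_display) (T : measurableType d)
    (P : probability T R) (Sigma : {RV P >-> (R * R)%type}) :
  0 <= b1 <= 1 -> 0 <= b2 <= 1 -> b1 < b2 ->
  has_density_f Sigma b1 b2 ->
  b2 < b1 + `|2 * upper_width b1 - 1| / 27 ->
  (2^-1 < upper_width b1 ->
    ((2^-1)%:E < P [set w | ((Sigma w).1 < (Sigma w).2)%R])%E) /\
  (upper_width b1 < 2^-1 ->
    (P [set w | ((Sigma w).1 < (Sigma w).2)%R] < (2^-1)%:E)%E).
Proof.
move=> b1_01 b2_01 b12 density near_b1.
have [m [-> mlo mhi]] := prob_lt_split b1_01 b2_01 b12 density.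
rewrite !lte_fin.
move: mlo mhi near_b1.
rewrite (_ : (1 - b2) * expR b1 = upper_width b1 - (b2 - b1) * expR b1);
  last by rewrite /upper_width; ring.
rewrite /breakpoint.
have [/andP[b10 b11] /andP[b20 b21]] := (b1_01, b2_01).
have e3 : expR 1 <= 3 :> R by have := expR1_le R; lra.
have p3 : expR b1 <= 3 by apply: le_trans e3; rewrite ler_expR.
have r3 : expR (b2 - b1) <= 3 by apply: le_trans e3; rewrite ler_expR; lra.
have p0 := expR_gt0 b1.
have r1 : 1 + (b2 - b1) <= expR (b2 - b1) by exact: expR_ge1Dx.
have : 0 < b2 - b1 by rewrite subr_gt0.
have -> : forall e, (b2 < b1 + e) = (b2 - b1 < e) by move=> e; rewrite ltrBlDl.
move: p3 r3 p0 r1; move: (b2 - b1) (expR _) (expR _) (upper_width b1) => t r p q.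
move=> p3 r3 p0 r1 t0 mlo mhi near.
(* Both exponentials are at most [e <= 3]; this is the 27 in the distance allowed between [b1] and
   [b2]. *)
have rp : r * p ^+ 2 <= 27.
  have : p ^+ 2 <= 9 by nra.
  by have := sqr_ge0 p; nra.
split=> hq.
- have qt : r * p ^+ 2 * t < 2 * q - 1.
    rewrite gtr0_norm in near; last lra.
    by nra.
  suff : 0 < (r - 1) * (2 * q - 1) - r * p ^+ 2 * t * t by lra.
  have : t * (2 * q - 1) <= (r - 1) * (2 * q - 1) by rewrite ler_wpM2r; lra.
  have : r * p ^+ 2 * t * t < (2 * q - 1) * t by rewrite ltr_pM2r.
  by lra.
- have qt : r * p ^+ 2 * t < 1 - 2 * q.
    rewrite ltr0_norm in near; last lra.
    by nra.
  have h1 : t * (1 - 2 * q) <= (r - 1) * (1 - 2 * q) by rewrite ler_wpM2r; lra.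
  have h2 : r * p ^+ 2 * t * t < (1 - 2 * q) * t by rewrite ltr_pM2r.
  (* The extra term of the upper bound has the favourable sign and is dropped. *)
  have h3 : 0 <= t * p * (r - 1) by rewrite !mulr_ge0; lra.
  by lra.
Qed.

Theorem corollary4 (R : realType) :
  (exists bhat : R,
    [/\ unique (fun b : R => 0 <= b <= 1 /\ (1 - b) * expR b - 2^-1 = 0) bhat,
        `|bhat - 768%:R / 1000%:R| < 2000%:R^-1,
        (forall b1 : R, 0 <= b1 <= 1 ->
          exists delta : R, 0 < delta /\
          forall b2 : R, 0 <= b2 <= 1 ->
            b1 < b2 -> b2 < bhat -> b2 < b1 + delta ->
          forall (d : measure_display) (T : measurableType d)
            (P : probability T R) (Sigma : {RV P >-> (R * R)%type}),
            has_density_f Sigma b1 b2 ->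
            (P [set w | ((Sigma w).1 < (Sigma w).2)%R] > (2^-1)%:E)%E)
      & (forall b1 : R, 0 <= b1 <= 1 ->
          bhat < b1 ->
          exists delta : R, 0 < delta /\
          forall b2 : R, 0 <= b2 <= 1 ->
            b1 < b2 -> b2 < b1 + delta ->
          forall (d : measure_display) (T : measurableType d)
            (P : probability T R) (Sigma : {RV P >-> (R * R)%type}),
            has_density_f Sigma b1 b2 ->
            (P [set w | ((Sigma w).1 < (Sigma w).2)%R] < (2^-1)%:E)%E)])
  /\
  (exists btilde : R,
    [/\ unique (fun b : R => 0 <= b < 1 /\ E b = 2^-1) btilde,
        `|btilde - 380%:R / 1000%:R| < 2000%:R^-1,
        (forall b : R, 0 <= b < btilde ->
          forall (d : measure_display) (T : measurableType d)
            (P : probability T R) (Sigma : {RV P >-> (R * R)%type}),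
            has_density_f Sigma b 1 ->
            (P [set w | ((Sigma w).1 < (Sigma w).2)%R] > (2^-1)%:E)%E)
      & (forall b : R, btilde < b < 1 ->
          forall (d : measure_display) (T : measurableType d)
            (P : probability T R) (Sigma : {RV P >-> (R * R)%type}),
            has_density_f Sigma b 1 ->
            (P [set w | ((Sigma w).1 < (Sigma w).2)%R] < (2^-1)%:E)%E)]).
Proof.
split.
  have [bhat [bhat01 Sbhat near_bhat]] := upper_width_root R.
  have /andP[bhat0 bhat1] := bhat01.
  have Slt b : bhat < b -> upper_width b < 2^-1.
    by move=> bb; rewrite -Sbhat upper_width_decr.
  have Sgt b : 0 <= b -> b < bhat -> 2^-1 < upper_width b.
    by move=> b0 bb; rewrite -Sbhat upper_width_decr.
  exists bhat; split=> //.
  - split; first by split=> //; rewrite -/(upper_width bhat) Sbhat subrr.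
    move=> b [/andP[b0 b1] /eqP]; rewrite subr_eq0 -/(upper_width b) => /eqP Sb.
    case: (ltgtP bhat b) => // [/Slt|/(Sgt _ b0)]; by rewrite Sb ltxx.
  - move=> b1 b1_01; have /andP[b10 b11] := b1_01.
    have [b1h|hb1] := ltP b1 bhat; last first.
      (* No [b2] lies between [b1] and the root here, so any positive distance serves. *)
      by exists 1; split=> // b2 _ b12 /(lt_trans b12); rewrite ltNge hb1.
    have Sb1 := Sgt _ b10 b1h.
    exists (`|2 * upper_width b1 - 1| / 27); split.
      by rewrite divr_gt0// normr_gt0; apply/eqP; lra.
    move=> b2 b2_01 b12 _ near_b1 d T P Sigma density.
    by have [/(_ Sb1)] := prob_lt_near b1_01 b2_01 b12 density near_b1.
  - move=> b1 b1_01 hb1; have Sb1 := Slt _ hb1.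
    exists (`|2 * upper_width b1 - 1| / 27); split.
      by rewrite divr_gt0// normr_gt0; apply/eqP; lra.
    move=> b2 b2_01 b12 near_b1 d T P Sigma density.
    by have [_ /(_ Sb1)] := prob_lt_near b1_01 b2_01 b12 density near_b1.
have [btilde [/andP[bt0 bt1] Ebt near_bt Elt Egt]] := E_root R.
exists btilde; split=> //.
- split; first by split=> //; rewrite bt0.
  move=> b [/andP[b0 b1] Eb]; case: (ltgtP btilde b) => // bb.
    by have := Egt b; rewrite bb b1 Eb ltxx => /(_ isT).
  by have := Elt b; rewrite b0 bb Eb ltxx => /(_ isT).
- move=> b b_lt d T P Sigma density; have /andP[b0 bbt] := b_lt.
  have b_01 : 0 <= b <= 1 by apply/andP; split; lra.
  move: (b0); rewrite le_eqVlt => /predU1P[/esym b_0|b_gt0].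
    exact: (prob_lt_uniform0 b_01 density b_0).
  rewrite (prob_lt_uniformE b_01 density b_gt0) lte_fin.
  by have := Elt b b_lt; lra.
- move=> b b_gt d T P Sigma density; have /andP[btb b1] := b_gt.
  have b_01 : 0 <= b <= 1 by apply/andP; split; lra.
  rewrite (prob_lt_uniformE b_01 density) ?lte_fin; last exact: le_lt_trans btb.
  by have := Egt b b_gt; lra.
Qed.
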